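(* Let $f\in L^*$ be a generic linear form with zero locus $TL\subseteq L$. For all $k\ge0$, in the left exact sequence $$0\to C_{L,k-1}\to C_{L,k}\to C_{TL,k},$$ where the first map is multiplication by $f$ and the second map is restriction of polynomials to $TL$, the map $C_{L,k}\to C_{TL,k}$ is surjective; equivalently, the restriction map $H^0(W_L,\mathcal{O}(1,\dots,1)(k\alpha))\to H^0(W_{TL},\mathcal{O}(1,\dots,1)(k\alpha))$ is surjective.
   Context: Let $L$ be a complex vector space of dimension $r\geq 1$, and let $\ell_1,\dots,\ell_n \in L^*$ be linear forms (possibly zero, possibly proportional) with zero loci $H_1,\dots,H_n$ satisfying $H_1\cap\dots\cap H_n=0$. ''Generic'' means belonging to a suitable nonempty Zariski-open subset of $L^*$. The hyperplane $TL=\{f=0\}\subset L$ carries the arrangement given by $\ell_j|_{TL}$, $j=1,\dots,n$. For an arrangement $(L,\ell_1,\dots,\ell_n)$: set $E=\{1,\dots,n\}$. A flat is a subset $F\subseteq E$ such that if $\bigcap_{i\in F}H_i\subseteq H_j$ then $j\in F$; put $L_F=\bigcap_{i\in F}H_i$; a flat is proper if $F\ne E$. The augmented wonderful variety $W_L$ is the smooth projective variety obtained from $\mathbb{P}(L\oplus\mathbb{C})$ by blowing up the strict transforms of the strata $\mathbb{P}(L_F)$ of the hyperplane at infinity $\mathbb{P}L$, for $F$ a proper flat, in increasing order of dimension. It contains $L$ as an open subset; $W_L\setminus L$ has irreducible components $D_F$, $F$ a proper flat, where $D_F$ is the strict transform of the exceptional divisor over $\mathbb{P}(L_F)$ (the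 strict transform of $\mathbb{P}L$ if $L_F=L$). $\alpha$ is the pullback of the hyperplane class of $\mathbb{P}(L\oplus\mathbb{C})$, $\mathcal{O}(1,\dots,1)$ is the pullback of $\mathcal{O}(1)^{\boxtimes n}$ under the map $W_L\to(\mathbb{P}^1)^n$ extending $(\ell_1,\dots,\ell_n)$, and $\mathcal{O}(1,\dots,1)(k\alpha)$ is identified with $\mathcal{O}(\sum_F(n-|F|+k)D_F)$ (sum over proper flats), so that its sections are polynomials on $L$. The closure of $TL$ in $W_L$ is identified with $W_{TL}$, and $\mathcal{O}_{W_L}(1,\dots,1)(k\alpha)$ restricts to $\mathcal{O}_{W_{TL}}(1,\dots,1)(k\alpha)$. For $v\in L$, $\rho(v)$ is the number of $i$ with $v\notin H_i$. $\operatorname{Sym}L$ acts on $\operatorname{Sym}L^*$ with $v\in L$ acting by the directional derivative; write $h\odot g$. $C_{L,k}=\{g\in\operatorname{Sym}L^*:h\odot g=0\text{ for all }h\in I\}$, where $I=(v^{\rho(v)+k+1}:v\in L\setminus\{0\})\subseteq\operatorname{Sym}L$ (the unit ideal if some exponent is $\le0$); it is equal to $H^0(W_L,\mathcal{O}(1,\dots,1)(k\alpha))$ as a subspace of $\operatorname{Sym}L^*$. $C_{TL,k}\subseteq\operatorname{Sym}(TL)^*$ is defined in the same way from the arrangement on $TL$. *)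

(* Defs.v *)
From mathcomp Require Export all_boot all_order all_algebra.
From mathcomp.multinomials Require Export mpoly.
From mathcomp Require Export reals complex.

Set Implicit Arguments.
Unset Strict Implicit.
Unset Printing Implicit Defensive.

Import GRing.Theory Num.Theory.
Local Open Scope ring_scope.

(* Conventions.  e_i is the i-th vector of the fixed basis [vbasis {:V}] of V
   and x_i the i-th coordinate function in that basis.  All notions below are
   independent of the basis. *)

Definition basis_vec (K : fieldType) (V : vectType K) (i : 'I_(\dim {:V})) : V :=
  (vbasis {:V})`_i.

Definition vcoord (K : fieldType) (V : vectType K) (i : 'I_(\dim {:V})) (v : V) : K :=
  coord (vbasis {:V}) i v.

(* Sym V, with 'X_i standing for e_i. *)
Definition symalg (K : fieldType) (V : vectType K) := {mpoly K[\dim {:V}]}.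

(* Sym V^*, with 'X_i standing for x_i. *)
Definition polyfun (K : fieldType) (V : vectType K) := {mpoly K[\dim {:V}]}.

Definition dual (K : fieldType) (V : vectType K) := 'Hom(V, K^o).

Definition vec_sym (K : fieldType) (V : vectType K) (v : V) : symalg V :=
  \sum_i vcoord i v *: 'X_i.

Definition form_poly (K : fieldType) (V : vectType K) (f : dual V) : polyfun V :=
  \sum_i (f (basis_vec i) : K) *: 'X_i.

Definition peval (K : fieldType) (V : vectType K) (g : polyfun V) (v : V) : K :=
  g.@[fun i => vcoord i v].

(* h (.) g: the constant-coefficient differential operator obtained from h by
   reading e_i as d/dx_i, applied to g.  Thus [vec_sym v] acts as the
   directional derivative along v. *)
Definition contract (K : fieldType) (V : vectType K)
    (h : symalg V) (g : polyfun V) : polyfun V :=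
  \sum_(m <- msupp h) h@_m *: g^`M[m].

(* Restriction of polynomials from V to a subspace U: each x_i is replaced by
   its expression in the coordinates of U. *)
Definition restrict (K : fieldType) (V : vectType K) (U : {vspace V})
    (g : polyfun V) : polyfun (subvs_of U) :=
  g \mPo [tuple \sum_(j < \dim {:subvs_of U})
                  vcoord i (vsval (basis_vec j)) *: 'X_j | i < \dim {:V}].

Definition ideal_gen (A : comNzRingType) (S : A -> Prop) (a : A) : Prop :=
  exists2 s : seq (A * A),
    (forall p, p \in s -> S p.2) & a = \sum_(p <- s) p.1 * p.2.

Fixpoint ideal_pow (A : comNzRingType) (I : A -> Prop) (m : nat) (a : A) : Prop :=
  if m is m'.+1 then
    ideal_gen (fun c => exists a' b, [/\ I a', ideal_pow I m' b & c = a' * b]) a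
  else True.

Definition vanishing_ideal (K : fieldType) (V : vectType K) (Z : V -> Prop)
    (g : polyfun V) : Prop :=
  forall v, Z v -> peval g v = 0.

Definition zariski_open (K : fieldType) (V : vectType K) (U : V -> Prop) : Prop :=
  exists S : polyfun V -> Prop,
    forall v, U v <-> exists2 p, S p & peval p v != 0.

(* max(z, 0) as a natural number. *)
Definition pos_part (z : int) : nat := if z is Posz m then m else 0%N.

Definition arrangement (K : fieldType) (V : vectType K) (n : nat) := 'I_n -> dual V.

Definition arr_restrict (K : fieldType) (V : vectType K) (n : nat) (U : {vspace V})
    (ell : arrangement V n) : arrangement (subvs_of U) n :=
  fun i => (ell i \o linfun (@vsval K V U))%VF.

Definition rho (K : fieldType) (V : vectType K) (n : nat) (ell : arrangement V n)
    (v : V) : nat :=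
  #|[set i | v \notin lker (ell i)]|.

(* The ideal I; an exponent <= 0 contributes the generator v^0 = 1. *)
Definition power_ideal (K : fieldType) (V : vectType K) (n : nat)
    (ell : arrangement V n) (k : int) : symalg V -> Prop :=
  ideal_gen (fun h => exists2 v : V, v != 0 &
    h = vec_sym v ^+ pos_part ((rho ell v)%:Z + k + 1)).

Definition inverse_system (K : fieldType) (V : vectType K) (n : nat)
    (ell : arrangement V n) (k : int) (g : polyfun V) : Prop :=
  forall h, power_ideal ell k h -> contract h g = 0.

Definition flat_space (K : fieldType) (V : vectType K) (n : nat)
    (ell : arrangement V n) (F : {set 'I_n}) : {vspace V} :=
  (\bigcap_(i in F) lker (ell i))%VS.

Definition is_flat (K : fieldType) (V : vectType K) (n : nat)
    (ell : arrangement V n) (F : {set 'I_n}) : Prop :=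
  forall j, (flat_space ell F <= lker (ell j))%VS -> j \in F.

Definition is_proper_flat (K : fieldType) (V : vectType K) (n : nat)
    (ell : arrangement V n) (F : {set 'I_n}) : Prop :=
  is_flat ell F /\ F != setT.

(* The cone in V (+) K over the stratum P(V_F) of the hyperplane at infinity of
   P(V (+) K); V is embedded in the latter by v |-> [v : 1]. *)
Definition stratum_cone (K : fieldType) (V : vectType K) (n : nat)
    (ell : arrangement V n) (F : {set 'I_n}) (p : (V * K^o)%type) : Prop :=
  p.1 \in flat_space ell F /\ p.2 = 0.

(* The pole of g along D_F has order at most m.  Blowing up the smaller strata
   does not change P(V (+) K) near the generic point of P(V_F), so the valuation
   of D_F is the order of vanishing along the smooth centre P(V_F): writing
   g = G / t^d with G homogeneous of degree d and t the coordinate of K,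
   ord_{D_F} g = ord_{P(V_F)} G - d, and ord_{P(V_F)} G is the largest e such
   that G lies in the e-th power of the homogeneous ideal of P(V_F) (these
   powers are saturated and primary, since the ideal is generated by linear
   forms). *)
Definition pole_order_le (K : fieldType) (V : vectType K) (n : nat)
    (ell : arrangement V n) (F : {set 'I_n}) (m : int) (g : polyfun V) : Prop :=
  exists d (G : polyfun (V * K^o)%type),
    [/\ G \is d.-homog,
        forall v : V, peval G (v, 1 : K^o) = peval g v
      & ideal_pow (vanishing_ideal (stratum_cone ell F)) (pos_part (d%:Z - m)) G].

(* H^0(W_V, O(1,...,1)(k alpha)) = H^0(W_V, O(sum_F (n - |F| + k) D_F)): rational
   functions on the normal variety W_V with no pole on V, hence polynomials on V,
   and a pole of order at most n - |F| + k along each boundary divisor D_F. *)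
Definition wonderful_sections (K : fieldType) (V : vectType K) (n : nat)
    (ell : arrangement V n) (k : int) (g : polyfun V) : Prop :=
  forall F : {set 'I_n}, is_proper_flat ell F ->
    pole_order_le ell F (n%:Z - #|F|%:Z + k) g.

(* 0 -> A -> B -> C is well defined and exact, where the subspaces A, B, C are
   given by their membership predicates. *)
Definition left_exact (X Y Z : zmodType) (A : X -> Prop) (B : Y -> Prop)
    (C : Z -> Prop) (phi : X -> Y) (psi : Y -> Z) : Prop :=
  [/\ forall x, A x -> B (phi x),
      forall y, B y -> C (psi y),
      forall x, A x -> phi x = 0 -> x = 0
    & forall y, B y -> (psi y = 0 <-> exists2 x, A x & y = phi x)].

(* psi restricts to a well-defined surjection from B onto C. *)
Definition maps_onto (Y Z : Type) (B : Y -> Prop) (C : Z -> Prop)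
    (psi : Y -> Z) : Prop :=
  (forall y, B y -> C (psi y)) /\ (forall z, C z -> exists2 y, B y & psi y = z).

(* Main.v *)
From HB Require Import structures.
From mathcomp Require Import boolp zify.
From mathcomp.multinomials Require Import ssrcomplements.
Require Import Defs.
Import GRing.Theory Num.Theory.
Local Open Scope ring_scope.

(* Along every line a polynomial g of C_{L,k} has degree at most rho(v) + k, v
   being the direction.  The key fact is that, for k >= 0, C_{L,k} is spanned by
   the products h * prod_(i in T) l_i with deg h <= k and T a set of indices; such
   products visibly lift along L -> TL, so restriction is onto.
   The spanning statement goes by deletion-contraction: restrict g to H_a, where
   by induction it agrees with a combination of products; the difference of g and
   this combination is l_a * q, and q satisfies the degree conditions for the
   arrangement without l_a.
   A product h * prod_(i in T) l_i, homogenized to degree n + k by replacing every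
   missing l_i by t, has the pole orders allowed in H^0(W_L, O(1,...,1)(k alpha));
   conversely the pole order along D_F, with F = {i : l_i(v) = 0}, bounds the degree
   in the direction v.
   Genericity of f is only needed for the kernel f * C_{L,k-1}: it provides, in each
   nonzero L_F, a vector on which f does not vanish. *)

Set Implicit Arguments.
Unset Strict Implicit.
Unset Printing Implicit Defensive.

(** * Induction on polynomials; univariate identities checked on values *)

Lemma mpoly_alg_ind (n : nat) (R : comNzRingType) (P : {mpoly R[n]} -> Prop) :
  (forall c, P c%:MP) -> (forall i, P 'X_i) ->
  (forall p q, P p -> P q -> P (p + q)) ->
  (forall p q, P p -> P q -> P (p * q)) -> forall p, P p.
Proof.
move=> PC PX PD PM p; rewrite (mpolyE p).
apply: (big_ind P) => [||m _]; [|exact: PD|]; first by rewrite -mpolyC0; exact: PC.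
rewrite -mul_mpolyC; apply: (PM); first exact: PC.
rewrite mpolyXE_id; apply: (big_ind P) => [||i _]; [|exact: PM|].
  by rewrite -mpolyC1; exact: PC.
elim: (m i) => [|j IHj]; first by rewrite expr0 -mpolyC1; exact: PC.
by rewrite exprS; exact: PM.
Qed.

Lemma poly_ext (K : numFieldType) (p q : {poly K}) :
  (forall s, p.[s] = q.[s]) -> p = q.
Proof.
move=> pq; apply/eqP; rewrite -subr_eq0; apply/negPn/negP => nz.
have := @max_poly_roots _ (p - q) [seq i%:R | i <- iota 0 (size (p - q))] nz.
rewrite size_map size_iota ltnn; case/(_ _ _)/notF => //.
  by apply/allP => s _; rewrite rootE hornerD hornerN pq subrr.
by rewrite map_inj_uniq ?iota_uniq // => i j /eqP; rewrite eqr_nat => /eqP.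
Qed.

Lemma poly_eq0_off0 (K : numFieldType) (p : {poly K}) :
  (forall s, s != 0 -> p.[s] = 0) -> p = 0.
Proof.
move=> p0; have : 'X * p = 0.
  apply: poly_ext => s; rewrite hornerM hornerX horner0.
  by have [->|/p0->] := eqVneq s 0; rewrite ?mul0r ?mulr0.
by move/eqP; rewrite mulf_eq0 polyX_eq0 => /eqP.
Qed.

(** * Evaluation, restriction to lines and contraction *)

Section Polynomials.
Context {K : numFieldType} {V : vectType K}.
Implicit Types (g p q : polyfun V) (h : symalg V) (x v w : V) (f : dual V) (s : K).

Lemma vcoordD i x v : vcoord i (x + v) = vcoord i x + vcoord i v.
Proof. by rewrite /vcoord linearD. Qed.

Lemma vcoordZ i s v : vcoord i (s *: v) = s * vcoord i v.
Proof. by rewrite /vcoord linearZ. Qed.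

Lemma vcoord_sum v : v = \sum_i vcoord i v *: basis_vec i.
Proof. exact: coord_vbasis (memvf v). Qed.

Lemma vcoord_basis i j : vcoord j (basis_vec i : V) = (i == j)%:R.
Proof. by rewrite /vcoord coord_free ?(basis_free (vbasisP _)) // eq_sym. Qed.

Lemma pevalC c v : peval (c%:MP : polyfun V) v = c.
Proof. exact: mevalC. Qed.

Lemma pevalX i v : peval ('X_i : polyfun V) v = vcoord i v.
Proof. exact: mevalXU. Qed.

Lemma pevalD p q v : peval (p + q) v = peval p v + peval q v.
Proof. exact: mevalD. Qed.

Lemma pevalB p q v : peval (p - q) v = peval p v - peval q v.
Proof. exact: mevalB. Qed.

Lemma pevalM p q v : peval (p * q) v = peval p v * peval q v.
Proof. exact: mevalM. Qed.

Lemma pevalZ s p v : peval (s *: p) v = s * peval p v.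
Proof. exact: mevalZ. Qed.

Lemma peval_sum I (r : seq I) (P : pred I) (F : I -> polyfun V) v :
  peval (\sum_(i <- r | P i) F i) v = \sum_(i <- r | P i) peval (F i) v.
Proof. exact: raddf_sum. Qed.

Lemma peval_prod I (r : seq I) (P : pred I) (F : I -> polyfun V) v :
  peval (\prod_(i <- r | P i) F i) v = \prod_(i <- r | P i) peval (F i) v.
Proof. exact: rmorph_prod. Qed.

Lemma peval_form f v : peval (form_poly f) v = f v.
Proof.
rewrite peval_sum {2}(vcoord_sum v) linear_sum; apply: eq_bigr => i _.
by rewrite pevalZ pevalX linearZ /= mulrC.
Qed.

(* The restriction s |-> g (x + s v) of g to a line. *)
Definition line g x v : {poly K} :=
  mmap (@polyC K) (fun i => (vcoord i x)%:P + vcoord i v *: 'X) g.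

Lemma lineD p q x v : line (p + q) x v = line p x v + line q x v.
Proof. exact: mmapD. Qed.

Lemma lineM p q x v : line (p * q) x v = line p x v * line q x v.
Proof. exact: rmorphM. Qed.

Lemma lineC c x v : line (c%:MP) x v = c%:P.
Proof. exact: mmapC. Qed.

Lemma lineX i x v : line 'X_i x v = (vcoord i x)%:P + vcoord i v *: 'X.
Proof. by rewrite /line mmapX mmap1U. Qed.

Lemma lineZ s p x v : line (s *: p) x v = s *: line p x v.
Proof. by rewrite -mul_mpolyC lineM lineC mul_polyC. Qed.

Lemma line_sum I (r : seq I) (P : pred I) (F : I -> polyfun V) x v :
  line (\sum_(i <- r | P i) F i) x v = \sum_(i <- r | P i) line (F i) x v.
Proof. exact: raddf_sum. Qed.

Lemma line_prod I (r : seq I) (P : pred I) (F : I -> polyfun V) x v :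
  line (\prod_(i <- r | P i) F i) x v = \prod_(i <- r | P i) line (F i) x v.
Proof. exact: rmorph_prod. Qed.

Lemma line_horner g x v s : (line g x v).[s] = peval g (x + s *: v).
Proof.
elim/mpoly_alg_ind: g => [c|i|p q IHp IHq|p q IHp IHq].
- by rewrite lineC pevalC hornerC.
- by rewrite lineX pevalX !hornerE vcoordD vcoordZ mulrC.
- by rewrite lineD pevalD hornerD IHp IHq.
- by rewrite lineM pevalM hornerM IHp IHq.
Qed.

Lemma line_form f x v : line (form_poly f) x v = (f x : K)%:P + (f v : K) *: 'X.
Proof.
apply: poly_ext => s; rewrite line_horner peval_form !hornerE.
by rewrite linearD linearZ /= mulrC.
Qed.

Lemma size_line_form f x v : (size (line (form_poly f) x v) <= (f v != 0%R).+1)%N.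
Proof.
rewrite line_form; have [->|nz] := eqVneq (f v) 0.
  by rewrite scale0r addr0 size_polyC_leq1.
rewrite addrC -mul_polyC size_MXaddC polyC_eq0 (negbTE nz) /=.
by rewrite size_polyC nz.
Qed.

(** An index set that does not depend on the support of [h] lets linearity in [h] be checked term by
    term. *)
Lemma contract_widen h g k : (msize h <= k)%N ->
  contract h g = \sum_(m : bmultinom (\dim {:V}) k) h@_m *: g^`M[m].
Proof.
move=> lek; set I : subFinType _ := bmultinom (\dim {:V}) k.
rewrite /contract (big_mksub I) ?msupp_uniq //=; first last.
  by move=> m /msize_mdeg_lt /leq_trans; apply.
by rewrite big_rmcond //= => m /memN_msupp_eq0 ->; rewrite scale0r.
Qed.

Lemma contractD h1 h2 g : contract (h1 + h2) g = contract h1 g + contract h2 g.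
Proof.
pose k := maxn (maxn (msize h1) (msize h2)) (msize (h1 + h2)).
rewrite !(@contract_widen _ _ k) /k ?leq_max ?leqnn ?orbT // -big_split /=.
by apply: eq_bigr => m _; rewrite mcoeffD scalerDl.
Qed.

Lemma contractZ s h g : contract (s *: h) g = s *: contract h g.
Proof.
pose k := maxn (msize h) (msize (s *: h)).
rewrite !(@contract_widen _ _ k) /k ?leq_max ?leqnn ?orbT // scaler_sumr.
by apply: eq_bigr => m _; rewrite mcoeffZ scalerA.
Qed.

Lemma contract0 g : contract (0 : symalg V) g = 0.
Proof. by rewrite /contract msupp0 big_nil. Qed.

Lemma contract_sum I (r : seq I) (P : pred I) (F : I -> symalg V) g :
  contract (\sum_(i <- r | P i) F i) g = \sum_(i <- r | P i) contract (F i) g.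
Proof.
apply: (big_morph (fun h : symalg V => contract h g) _ (contract0 g)) => a b.
exact: contractD.
Qed.

Lemma contract_mon m g : contract ('X_[m] : symalg V) g = g^`M[m].
Proof. by rewrite /contract msuppX big_seq1 mcoeffX eqxx scale1r. Qed.

Lemma contractX i g : contract ('X_i : symalg V) g = g^`M(i).
Proof. by rewrite contract_mon mderivmU1m. Qed.

Lemma contractC c g : contract (c%:MP : symalg V) g = c *: g.
Proof. by rewrite -(mulr1 c%:MP) mul_mpolyC contractZ -mpolyX0 contract_mon mderivm0m. Qed.

Lemma contractM h1 h2 g : contract (h1 * h2) g = contract h1 (contract h2 g).
Proof.
elim/mpoly_alg_ind: h1 h2 g => [c|i|p q IHp IHq|p q IHp IHq] h2 g.
- by rewrite mul_mpolyC contractZ contractC.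
- rewrite contractX {1}(mpolyE h2) mulr_sumr contract_sum [in RHS]/contract raddf_sum /=.
  apply: eq_bigr => m _.
  by rewrite -scalerAr contractZ -mpolyXD contract_mon addmC mderivmDm mderivmU1m linearZ.
- by rewrite mulrDl !contractD IHp IHq.
- by rewrite -mulrA IHp IHq -IHp.
Qed.

Lemma contract_vec v g :
  contract (vec_sym v) g = \sum_i vcoord i v *: g^`M(i).
Proof.
by rewrite contract_sum; apply: eq_bigr => i _; rewrite contractZ contractX.
Qed.

(** Chain rule: both sides obey the sum and product rules in [g], so constants and coordinates
    decide. *)
Lemma line_deriv g x v : (line g x v)^`() = line (contract (vec_sym v) g) x v.
Proof.
rewrite contract_vec line_sum.
under eq_bigr do rewrite lineZ.
elim/mpoly_alg_ind: g => [c|i|p q IHp IHq|p q IHp IHq].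
- rewrite lineC derivC big1 // => i _.
  by rewrite mderivC -mpolyC0 lineC polyC0 scaler0.
- rewrite lineX derivD derivC derivZ derivX add0r (bigD1 i) //= mderivX mnm1E eqxx.
  have -> : (U_(i) - U_(i) = 0)%MM by apply/mnmP => j; rewrite mnmBE mnm0E subnn.
  rewrite scale1r mpolyX0 -mpolyC1 lineC polyC1 big1 ?addr0 // => j ji.
  by rewrite mderivX mnm1E eq_sym (negbTE ji) scale0r -mpolyC0 lineC polyC0 scaler0.
- rewrite lineD derivD IHp IHq -big_split /=; apply: eq_bigr => i _.
  by rewrite mderivD lineD scalerDr.
- rewrite lineM derivM IHp IHq mulr_suml mulr_sumr -big_split /=.
  apply: eq_bigr => i _.
  by rewrite mderivM lineD !lineM scalerDr scalerAl scalerAr.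
Qed.

Lemma line_derivn g x v e : (line g x v)^`(e) = line (contract (vec_sym v ^+ e) g) x v.
Proof.
elim: e => [|e IHe].
  by rewrite derivn0 expr0 -mpolyC1 contractC scale1r.
by rewrite derivnS IHe line_deriv exprS contractM.
Qed.

Lemma peval_line0 g x v : peval g x = (line g x v).[0].
Proof. by rewrite line_horner scale0r addr0. Qed.

Lemma vec_sym_basis i : vec_sym (basis_vec i : V) = 'X_i.
Proof.
rewrite /vec_sym (bigD1 i) //= vcoord_basis eqxx scale1r big1 ?addr0 // => j ji.
by rewrite vcoord_basis eq_sym (negbTE ji) scale0r.
Qed.

(** If all values vanish, so do all values of all derivatives; each coefficient is, up to a nonzero
    product of factorials, the value of a derivative at 0. *)
Lemma peval_eq0 g : (forall x, peval g x = 0) -> g = 0.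
Proof.
have key h : forall g, (forall x, peval g x = 0) ->
    forall x, peval (contract h g) x = 0.
  elim/mpoly_alg_ind: h => [c|i|p q IHp IHq|p q IHp IHq] {}g g0 x.
  - by rewrite contractC pevalZ g0 mulr0.
  - rewrite -vec_sym_basis (peval_line0 _ _ (basis_vec i)) -line_deriv.
    suff -> : line g x (basis_vec i) = 0 by rewrite deriv0 horner0.
    by apply: poly_ext => s; rewrite line_horner g0 horner0.
  - by rewrite contractD pevalD IHp // IHq // addr0.
  - by rewrite contractM IHp // => y; rewrite IHq.
move=> g0; apply/mpolyP => m; rewrite mcoeff0.
have := key 'X_[m] g g0 0; rewrite contract_mon.
have -> : peval g^`M[m] 0 = (g^`M[m])@_0.
  elim/mpoly_alg_ind: (g^`M[m]) => [c|i|p q IHp IHq|p q IHp IHq].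
  - by rewrite pevalC mcoeffC eqxx mulr1.
  - rewrite pevalX /vcoord linear0 mcoeffX.
    by case: eqP => // /(congr1 mdeg); rewrite mdeg1 mdeg0.
  - by rewrite pevalD IHp IHq mcoeffD.
  - by rewrite pevalM IHp IHq; exact/esym/(rmorphM (mcoeff 0%MM)).
move/eqP; rewrite mcoeff_mderivm addm0 mulrn_eq0 => /orP[|/eqP//].
rewrite eqn0Ngt prodn_gt0 // => i.
by rewrite ffactnn fact_gt0.
Qed.

Lemma peval_inj p q : (forall x, peval p x = peval q x) -> p = q.
Proof.
move=> pq; apply/eqP; rewrite -subr_eq0; apply/eqP/peval_eq0 => x.
by rewrite pevalB pq subrr.
Qed.

(** Dictionary between generators of the power ideal and degrees on lines: the [e]-th derivative of
    [line g x v] is the line polynomial of the contraction, and in characteristic 0 it vanishes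
    exactly when the degree is below [e]. *)
Lemma contract_pow_eq0 v e g :
  contract (vec_sym v ^+ e) g = 0 <-> forall x, (size (line g x v) <= e)%N.
Proof.
split=> [h0 x|sz].
  apply/leq_sizeP => j /subnKC <-; have := congr1 (fun p : {poly K} => p`_(j - e)) (line_derivn g x v e).
  rewrite h0 -mpolyC0 lineC coefC coef_derivn => /eqP.
  rewrite if_same mulrn_eq0 => /orP[|/eqP//].
  by rewrite eqn0Ngt ffact_gt0 leq_addr.
apply: peval_eq0 => x; rewrite (peval_line0 _ x v) -line_derivn.
by rewrite derivn_poly0 ?horner0.
Qed.

End Polynomials.

(** * Pullback along linear maps and restriction to subspaces *)

Lemma exists_pullback (K : numFieldType) (V W : vectType K) (phi : 'Hom(V, W))
    (g : polyfun W) :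
  exists g' : polyfun V, forall v, peval g' v = peval g (phi v).
Proof.
elim/mpoly_alg_ind: g => [c|i|p q [p' hp] [q' hq]|p q [p' hp] [q' hq]].
- by exists c%:MP => v; rewrite !pevalC.
- exists (form_poly (linfun (coord (vbasis {:W}) i : W -> K^o) \o phi)%VF) => v.
  by rewrite peval_form comp_lfunE lfunE pevalX.
- by exists (p' + q') => v; rewrite !pevalD hp hq.
- by exists (p' * q') => v; rewrite !pevalM hp hq.
Qed.

Lemma peval_restrict (K : numFieldType) (V : vectType K) (U : {vspace V})
    (g : polyfun V) (u : subvs_of U) :
  peval (restrict U g) u = peval g (vsval u).
Proof.
rewrite /peval /restrict comp_mpoly_meval; apply: meval_eq => i.
rewrite tnth_mktuple -/(peval _ u) peval_sum [in RHS](vcoord_sum u).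
rewrite linear_sum /vcoord linear_sum; apply: eq_bigr => j _.
by rewrite pevalZ pevalX !linearZ /= mulrC.
Qed.

Lemma line_restrict (K : numFieldType) (V : vectType K) (U : {vspace V})
    (g : polyfun V) (x v : subvs_of U) :
  line (restrict U g) x v = line g (vsval x) (vsval v).
Proof.
apply: poly_ext => s.
by rewrite !line_horner peval_restrict linearD linearZ.
Qed.

(** * Division by a linear form *)

Section Division.
Context {K : numFieldType} {V : vectType K}.
Implicit Types (g p q : polyfun V) (x v w : V) (f : dual V) (U : {vspace V}).

Lemma dualD f x v : f (x + v) = f x + f v :> K.
Proof. by rewrite linearD. Qed.

Lemma dualB f x v : f (x - v) = f x - f v :> K.
Proof. by rewrite linearB. Qed.

Lemma dualZ f (s : K) v : f (s *: v) = s * f v :> K.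
Proof. by rewrite linearZ. Qed.

(* When f w = 1, [x - f x *: w] is the projection of x to the kernel of f. *)
Lemma exists_quotient f w g :
  exists q, forall x, peval g x - peval g (x - (f x : K) *: w) = (f x : K) * peval q x.
Proof.
(* The pullback [g'] along the projection is carried along as a polynomial because it enters the
   quotient of a product, [q1 * p2 + p1' * q2]. *)
suff [g' [q [hg' qE]]] : exists g' q, (forall x, peval g' x = peval g (x - (f x : K) *: w)) /\
    forall x, peval g x - peval g' x = (f x : K) * peval q x.
  by exists q => x; rewrite -qE hg'.
elim/mpoly_alg_ind: g => [c|i|p1 p2 [p1' [q1 [h1 e1]]] [p2' [q2 [h2 e2]]]
                             |p1 p2 [p1' [q1 [h1 e1]]] [p2' [q2 [h2 e2]]]].
- by exists c%:MP, 0%:MP; split=> x; rewrite !pevalC ?subrr ?mulr0.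
- exists ('X_i - form_poly f * (vcoord i w)%:MP), (vcoord i w)%:MP.
  split=> x; rewrite pevalB pevalM !pevalX pevalC peval_form.
    by rewrite -scaleNr vcoordD vcoordZ mulNr.
  by rewrite opprB addrC subrK.
- exists (p1' + p2'), (q1 + q2); split=> x; rewrite !pevalD; first by rewrite h1 h2.
  by rewrite mulrDr -e1 -e2 opprD addrACA.
- exists (p1' * p2'), (q1 * p2 + p1' * q2); split=> x; rewrite !pevalM; first by rewrite h1 h2.
  rewrite pevalD !pevalM mulrDr mulrA -e1 mulrCA -e2 mulrBl mulrBr.
  by rewrite addrA subrK.
Qed.

(* The coefficients of the line polynomial depend polynomially on c, so those that
   vanish for c <> 0 also vanish at 0. *)
Lemma size_line_limit g x x' v v' e :
  (forall c : K, c != 0 -> (size (line g (x + c *: x') (v + c *: v')) <= e)%N) ->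
  (size (line g x v) <= e)%N.
Proof.
(* The inner variable of [B] is the deformation parameter [c], the outer one the parameter of the
   line. *)
have [B hB] : exists B : {poly {poly K}},
    forall c, line g (x + c *: x') (v + c *: v') = map_poly (horner_eval c) B.
  elim/mpoly_alg_ind: g => [a|i|p q [P hP] [Q hQ]|p q [P hP] [Q hQ]].
  - exists a%:P%:P => c.
    by rewrite lineC map_polyC /= /horner_eval hornerC.
  - exists (((vcoord i x)%:P + vcoord i x' *: 'X)%:P +
            ((vcoord i v)%:P + vcoord i v' *: 'X) *: 'X) => c.
    rewrite lineX rmorphD /= map_polyC map_polyZ map_polyX /= /horner_eval.
    by rewrite !hornerE !vcoordD !vcoordZ !(mulrC c).
  - by exists (P + Q) => c; rewrite lineD hP hQ rmorphD.
  - by exists (P * Q) => c; rewrite lineM hP hQ rmorphM.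
move=> sz; apply/leq_sizeP => j ej.
have -> : line g x v = map_poly (horner_eval 0) B.
  by rewrite -hB !scale0r !addr0.
rewrite coef_map /= /horner_eval.
suff -> : B`_j = 0 by rewrite horner0.
apply: poly_eq0_off0 => c /sz/leq_sizeP/(_ j ej).
by rewrite hB coef_map.
Qed.

(** On lines inside [U], [g] factors as [f] times [q]. If [f v] is nonzero, the factor [f] has
    degree one and accounts for the extra 1. Otherwise it is the constant [f x], which cancels when
    nonzero; points with [f x = 0] are limits of points [x + c *: w], where it is nonzero. *)
Lemma size_line_quotient U g f q w v e :
  (forall x, x \in U -> peval g x = (f x : K) * peval q x) ->
  w \in U -> f w != 0 -> v \in U ->
  (forall x, x \in U -> (size (line g x v) <= e + (f v != 0%R))%N) ->
  forall x, x \in U -> (size (line q x v) <= e)%N.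
Proof.
move=> gq wU fw0 vU sz.
have lineE x : x \in U -> line g x v = line (form_poly f) x v * line q x v.
  move=> xU; apply: poly_ext => s.
  by rewrite hornerM !line_horner peval_form gq // memvD // memvZ.
have [fv0|fv0] := eqVneq (f v) 0; last first.
  move=> x xU; have := sz x xU; rewrite lineE // fv0 addn1 line_form.
  have [->|q0] := eqVneq (line q x v) 0; first by rewrite size_poly0.
  have s2 : size ((f x : K)%:P + (f v : K) *: 'X) = 2.
    by rewrite addrC -mul_polyC size_MXaddC polyC_eq0 (negbTE fv0) /= size_polyC fv0.
  by rewrite size_mul ?s2 // -size_poly_eq0 s2.
have key x : x \in U -> f x != 0 -> (size (line q x v) <= e)%N.
  move=> xU fx0; have := sz x xU; rewrite lineE // fv0 eqxx addn0 line_form fv0.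
  by rewrite scale0r addr0 mul_polyC size_scale.
move=> x xU; have [fx0|] := eqVneq (f x) 0; last exact: key.
apply: (@size_line_limit _ _ w _ 0) => c c0.
rewrite scaler0 addr0; apply: key; first by rewrite memvD ?memvZ.
by rewrite dualD dualZ fx0 add0r mulf_neq0.
Qed.
End Division.

(** * Products of the forms, and spanning by deletion-contraction *)

Section Zonotopal.
Context {K : numFieldType} {V : vectType K} {n : nat}.
Variables (ell : arrangement V n) (k : nat).
Implicit Types (g p q h : polyfun V) (x v w : V) (U : {vspace V}) (S T : {set 'I_n}).

Lemma rhoE v : rho ell v = #|[set i | ell i v != 0%R]|.
Proof. by apply: eq_card => i; rewrite !inE memv_ker. Qed.

(* "deg h <= k" is expressed line by line, like the conditions defining C_{L,k}. *)
Inductive zonotopal S : polyfun V -> Prop :=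
| zonotopal_prod T h : T \subset S -> (forall x v, (size (line h x v) <= k.+1)%N) ->
    zonotopal S (h * \prod_(i in T) form_poly (ell i))
| zonotopal_add p q : zonotopal S p -> zonotopal S q -> zonotopal S (p + q).

Lemma zonotopalS S S' p : S \subset S' -> zonotopal S p -> zonotopal S' p.
Proof.
move=> sS; elim=> [T h sT hk|{}p q _ IHp _ IHq]; last exact: zonotopal_add.
by apply: zonotopal_prod => //; apply: subset_trans sT sS.
Qed.

(** No index set [T] inside [S :\ a] contains [a], so the new factor never repeats an index. *)
Lemma zonotopal_mul S a p : a \in S -> zonotopal (S :\ a) p ->
  zonotopal S (form_poly (ell a) * p).
Proof.
move=> aS; elim=> [T h sT hk|{}p q _ IHp _ IHq]; last first.
  by rewrite mulrDr; exact: zonotopal_add.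
rewrite mulrCA -big_setU1 /=; last by apply: contraTN sT => aT; apply/subsetPn; exists a; rewrite ?inE ?eqxx.
apply: zonotopal_prod => //; rewrite subUset sub1set aS.
exact: subset_trans sT (subD1set _ _).
Qed.

(** Factors with [ell i v = 0] are constant along the line, the others have degree one, and [h]
    contributes at most [k]. *)
Lemma size_line_zonotopal S p x v : zonotopal S p ->
  (size (line p x v) <= (#|[set i in S | ell i v != 0%R]| + k).+1)%N.
Proof.
elim=> [T h sT hk|{}p q _ IHp _ IHq]; last first.
  by rewrite lineD (leq_trans (size_polyD _ _)) // geq_max IHp IHq.
rewrite lineM line_prod; apply: leq_trans (size_polyMleq _ _) _.
suff szT : (size (\prod_(i in T) line (form_poly (ell i)) x v)%R <=
          #|[set i in S | ell i v != 0%R]|.+1)%N.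
  by have := hk x v; move: szT; lia.
apply: leq_trans (size_poly_prod_leq _ _) _.
have le1 : (\sum_(i in T) size (line (form_poly (ell i)) x v) <=
            \sum_(i in T) (1 + (ell i v != 0%R)))%N.
  by apply: leq_sum => i _; rewrite add1n size_line_form.
have le2 : (\sum_(i in T) (ell i v != 0%R) <= #|[set i in S | ell i v != 0%R]|)%N.
  rewrite -big_mkcondr /= sum1_card subset_leq_card //.
  by apply/subsetP => i /andP[/(subsetP sT) iS iv]; rewrite inE iS.
rewrite leq_subLR addnS ltnS; apply: leq_trans le1 _.
by rewrite big_split /= sum1_card leq_add2l.
Qed.

(** Stating the claim relative to a subspace [U] keeps the ambient polynomial ring fixed:
    contraction only replaces [U] by its intersection with a hyperplane. The case [U = fullv] gives
    spanning, and [U = TL] gives surjectivity. *)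
Lemma zonotopal_restrict S U g :
  (forall v, v \in U -> v != 0 -> forall x, x \in U ->
     (size (line g x v) <= (#|[set i in S | ell i v != 0%R]| + k).+1)%N) ->
  exists2 p, zonotopal S p & forall u, u \in U -> peval p u = peval g u.
Proof.
elim: {S}_.+1 {-2}S (ltnSn #|S|) U g => // N IHN S ltS U g deg_g.
(* Without forms, [g] has degree at most [k] on [U]; composing with the projection onto [U] carries
   this bound to all of [V]. *)
have [S0|[a aS]] := set_0Vmem S.
  have [h hE] := exists_pullback (projv U) g.
  exists (h * \prod_(i in set0) form_poly (ell i)); last first.
    by move=> u uU; rewrite big_set0 mulr1 hE projv_id.
  apply: zonotopal_prod => [|x v]; first exact: sub0set.
  (* The hypothesis does not cover the zero direction, along which the line polynomial is
     constant. *)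
  have -> : line h x v = line g (projv U x) (projv U v).
    by apply: poly_ext => s; rewrite !line_horner hE linearD linearZ.
  have [->|v0] := eqVneq (projv U v) 0.
    have -> : line g (projv U x) 0 = (peval g (projv U x))%:P.
      by apply: poly_ext => s; rewrite line_horner scaler0 addr0 hornerC.
    by rewrite (leq_trans (size_polyC_leq1 _)).
  apply: leq_trans (deg_g _ (memv_proj _ _) v0 _ (memv_proj _ _)) _.
  by rewrite S0 [X in #|pred_of_set X|](_ : _ = set0) ?cards0 //; apply/setP => i; rewrite !inE.
have ltSa : (#|S :\ a| < N)%N by move: ltS; rewrite (cardsD1 a S) aS; lia.
have cardSa v : #|[set i in S | ell i v != 0%R]| =
    ((ell a v != 0%R) + #|[set i in S :\ a | ell i v != 0%R]|)%N.
  rewrite (cardsD1 a) inE aS /=; congr (_ + _)%N.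
  by apply: eq_card => i; rewrite !inE andbA.
have [Ua|] := boolP (U <= lker (ell a))%VS.
  have [|p pS pg] := IHN (S :\ a) ltSa U g; last first.
    by exists p => //; exact: zonotopalS (subD1set _ _) pS.
  move=> v vU v0 x xU; apply: leq_trans (deg_g v vU v0 x xU) _.
  by rewrite cardSa; move/subvP: Ua => /(_ v vU); rewrite memv_ker => /eqP->; rewrite eqxx.
case/subvPn => w0 w0U; rewrite memv_ker => aw0.
pose w := (ell a w0 : K)^-1 *: w0.
have wU : w \in U by rewrite memvZ.
have aw : ell a w = 1 by rewrite dualZ mulVf.
(* Contraction: directions in the kernel of [ell a] do not count [a], so [S :\ a] satisfies the
   bound there. *)
have [|p1 p1S p1g] := IHN (S :\ a) ltSa (U :&: lker (ell a))%VS g.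
  move=> v; rewrite memv_cap memv_ker => /andP[vU /eqP av] v0 x.
  rewrite memv_cap => /andP[xU _].
  by apply: leq_trans (deg_g v vU v0 x xU) _; rewrite cardSa av eqxx.
have p1S' : zonotopal S p1 by apply: zonotopalS p1S; exact: subD1set.
(* For [x] in [U] the projection [x - ell a x *: w] lies in [U] and in the kernel, where [g - p1]
   vanishes; hence [g - p1] is [ell a] times [q] on [U]. *)
have [q qE] := exists_quotient (ell a) w (g - p1).
have gE x : x \in U -> peval (g - p1) x = (ell a x : K) * peval q x.
  move=> xU; rewrite -qE [X in _ = _ - X]pevalB p1g ?subrr ?subr0 //.
  rewrite memv_cap memvB ?memvZ //= memv_ker dualB dualZ aw.
  by rewrite mulr1 subrr.
(* Deletion: dividing by [ell a] lowers the bound exactly in the directions that counted [a]. *)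
have [|p2 p2S p2q] := IHN (S :\ a) ltSa U q.
  move=> v vU v0; apply: (size_line_quotient gE wU) => //; first by rewrite aw oner_eq0.
  move=> x xU.
  have -> : line (g - p1) x v = line g x v - line p1 x v.
    by rewrite lineD -scaleN1r lineZ scaleN1r.
  apply: leq_trans (size_polyD _ _) _; rewrite size_polyN geq_max addnC addnS addnA -cardSa.
  by rewrite deg_g ?size_line_zonotopal.
exists (p1 + form_poly (ell a) * p2).
  by apply: zonotopal_add => //; exact: zonotopal_mul.
move=> u uU; rewrite pevalD pevalM peval_form p2q // -gE // pevalB.
by rewrite addrC subrK.
Qed.
End Zonotopal.

(** * The inverse system as degree bounds along lines *)

Section InverseSystem.
Context {K : numFieldType} {V : vectType K} {n : nat}.
Variable (ell : arrangement V n).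
Implicit Types (g p q h : polyfun V) (x v w : V).

(** Contraction with a multiple of a generator factors through the generator, so the generators
    decide. *)
Lemma inverse_systemP (k : int) g : inverse_system ell k g <->
  forall v, v != 0 -> forall x,
    (size (line g x v) <= pos_part ((rho ell v)%:Z + k + 1))%N.
Proof.
split=> [gk v v0|sz h [s sP ->]].
  apply/contract_pow_eq0/gk.
  exists [:: (1, vec_sym v ^+ pos_part ((rho ell v)%:Z + k + 1))].
    by move=> q; rewrite inE => /eqP-> /=; exists v.
  by rewrite big_seq1 mul1r.
rewrite contract_sum big_seq big1 // => q /sP [v v0 ->].
have /contract_pow_eq0 q0 := sz v v0.
rewrite contractM q0 /contract big1 // => m _.
by rewrite linear0 scaler0.
Qed.

Lemma inverse_system_natP (k : nat) g : inverse_system ell k%:Z g <->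
  forall v, v != 0 -> forall x, (size (line g x v) <= (rho ell v + k).+1)%N.
Proof.
by split=> [/inverse_systemP|] sz; [|apply/inverse_systemP] => v v0 x;
  have := sz v v0 x; rewrite -!PoszD addn1.
Qed.

Lemma inverse_system_predP (k : nat) g : inverse_system ell (k%:Z - 1) g <->
  forall v, v != 0 -> forall x, (size (line g x v) <= rho ell v + k)%N.
Proof.
by split=> [/inverse_systemP|] sz; [|apply/inverse_systemP] => v v0 x;
  have := sz v v0 x; rewrite -addrA subrK -!PoszD.
Qed.

Lemma zonotopal_inverse_system (k : nat) g :
  zonotopal ell k setT g -> inverse_system ell k%:Z g.
Proof.
move=> gP; apply/inverse_system_natP => v v0 x.
have := size_line_zonotopal x v gP; rewrite rhoE.
by rewrite (@eq_card _ (mem [set i in setT | _]) (mem [set i | ell i v != 0%R])) // => i; rewrite !inE.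
Qed.

(** The spanning statement: for [U = fullv], agreement on [U] is equality of polynomials. *)
Lemma inverse_system_zonotopal (k : nat) g :
  inverse_system ell k%:Z g -> zonotopal ell k setT g.
Proof.
move=> /inverse_system_natP gP.
have [v _ v0 x _|p pP pg] := @zonotopal_restrict _ _ _ ell k setT fullv g.
  apply: leq_trans (gP v v0 x) _; rewrite rhoE !ltnS leq_add2r subset_leq_card //.
  by apply/subsetP => i; rewrite !inE.
by rewrite -(@peval_inj _ _ p g) // => x; apply: pg; rewrite memvf.
Qed.
End InverseSystem.

(** * Powers of ideals and homogenization *)

Lemma ideal_gen_add (A : comNzRingType) (S : A -> Prop) a b :
  ideal_gen S a -> ideal_gen S b -> ideal_gen S (a + b).
Proof.
move=> [s sS ->] [t tS ->]; exists (s ++ t); last by rewrite big_cat.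
by move=> p; rewrite mem_cat => /orP[/sS|/tS].
Qed.

Lemma ideal_pow_add (A : comNzRingType) (I : A -> Prop) m a b :
  ideal_pow I m a -> ideal_pow I m b -> ideal_pow I m (a + b).
Proof. by case: m => // m; exact: ideal_gen_add. Qed.

Lemma ideal_pow_prod (A : comNzRingType) (I : A -> Prop) (T : Type) (s : seq T)
    (F : T -> A) a :
  (forall i, I (F i)) -> ideal_pow I (size s) (a * \prod_(i <- s) F i).
Proof.
move=> IF; elim: s => //= i s IHs.
exists [:: (1, F i * (a * \prod_(j <- s) F j))].
  by move=> p; rewrite inE => /eqP-> /=; exists (F i), (a * \prod_(j <- s) F j).
by rewrite big_seq1 mul1r big_cons mulrCA.
Qed.

Section Homogenization.
Context {K : numFieldType} {V : vectType K}.
Local Notation VK := (V * K^o)%type.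

Lemma dhomog_form (W : vectType K) (f : dual W) : form_poly f \is 1.-homog.
Proof. by apply: rpred_sum => i _; rewrite dhomogZ // dhomogX /= mdeg1. Qed.

Lemma dhomog_prod_linear (N : nat) (I : Type) (s : seq I)
    (F : I -> {mpoly K[N]}) :
  (forall i, F i \is 1.-homog) -> \prod_(i <- s) F i \is (size s).-homog.
Proof.
move=> F1; elim: s => [|i s IHs]; first by rewrite big_nil dhomog1.
by rewrite big_cons /= -add1n dhomogM.
Qed.

Lemma peval_dhomog (W : vectType K) (d : nat) (G : polyfun W) s w :
  G \is d.-homog -> peval G (s *: w) = s ^+ d * peval G w.
Proof.
move=> Gd; rewrite /peval !mevalE mulr_sumr big_seq [RHS]big_seq.
apply: eq_bigr => m mG; have md : mdeg m = d := dhomogP _ _ _ Gd m mG.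
rewrite mulrCA -md; congr (_ * _); rewrite mdegE -prodrXr -big_split /=; apply: eq_bigr => i _.
by rewrite vcoordZ exprMn.
Qed.

Definition dual_fst (f : dual V) : dual VK := (f \o linfun fst)%VF.
Definition dual_snd : dual VK := linfun snd.

Lemma dual_fstE f v s : dual_fst f (v, s) = f v.
Proof. by rewrite comp_lfunE lfunE. Qed.

Lemma dual_sndE v s : dual_snd (v, s) = s.
Proof. by rewrite lfunE. Qed.

(** Each monomial of degree at most [k] receives the missing power of [t]. Higher monomials are left
    out: by the bound on the line from 0 along [v], their total contribution at [v] is zero. *)
Lemma exists_homogenization k (h : polyfun V) :
  (forall x v, (size (line h x v) <= k.+1)%N) ->
  exists2 H : polyfun VK, H \is k.-homog &
    forall v, peval H (v, 1 : K^o) = peval h v.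
Proof.
move=> hk.
pose c i : dual VK := dual_fst (linfun (coord (vbasis {:V}) i : V -> K^o)).
pose H : polyfun VK := \sum_(m <- msupp h | (mdeg m <= k)%N)
  h@_m *: ((\prod_i form_poly (c i) ^+ m i) * form_poly dual_snd ^+ (k - mdeg m)).
exists H.
  apply: rpred_sum => m mk; rewrite dhomogZ // -{2}(subnKC mk) dhomogM //.
    rewrite mdegE; apply: (big_ind2 (fun p d => p \is d.-homog)).
    - exact: dhomog1.
    - by move=> p1 d1 p2 d2; exact: dhomogM.
    - by move=> i _; rewrite -{2}(mul1n (m i)) dhomogMn ?dhomog_form.
  by rewrite -{2}(mul1n (k - _)%N) dhomogMn ?dhomog_form.
move=> v; rewrite peval_sum.
have -> : peval h v = (line h 0 v).[1] by rewrite line_horner add0r scale1r.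
rewrite (horner_coef_wide _ (hk 0 v)).
have lineE : line h 0 v =
    \sum_(m <- msupp h) (h@_m * \prod_i vcoord i v ^+ m i) *: 'X^(mdeg m).
  apply: eq_bigr => m _; rewrite -mul_polyC polyCM -mulrA; congr (_ * _).
  rewrite mul_polyC mdegE -prodrXr -scaler_prod /mmap1; apply: eq_bigr => i _.
  by rewrite /vcoord linear0 add0r exprZn.
rewrite lineE; under [RHS]eq_bigr do rewrite expr1n mulr1 coef_sum.
rewrite exchange_big /= [LHS]big_mkcond /=; apply: eq_bigr => m _.
under [RHS]eq_bigr do rewrite coefZ coefXn.
rewrite pevalZ pevalM peval_prod /peval !rmorphXn /= -!/(peval _ _).
rewrite peval_form dual_sndE expr1n mulr1.
under eq_bigr do rewrite rmorphXn /= -/(peval _ _) peval_form dual_fstE lfunE /=.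
rewrite -mulr_sumr; case: leqP => mk.
  rewrite (bigD1 (inord (mdeg m))) //= inordK // eqxx [\sum_(_ < _ | _) _]big1 ?addr0 ?mulr1 //.
  by move=> i im; case: eqP => // e; case/eqP: im; apply: val_inj; rewrite /= inordK.
rewrite [\sum_(_ < _) _]big1 ?mulr0 // => i _; case: eqP => // e.
by have := ltn_ord i; rewrite e ltnS leqNgt mk.
Qed.
End Homogenization.

(** Each of the [e] factors from the ideal vanishes at [x], so its line polynomial is divisible by
    ['X]. *)
Lemma line_ideal_pow (K : numFieldType) (W : vectType K) (Z : W -> Prop) e (G : polyfun W)
    (x v : W) :
  Z x -> ideal_pow (vanishing_ideal Z) e G ->
  exists r : {poly K}, line G x v = r * 'X^e.
Proof.
move=> Zx; elim: e G => [|e IHe] G; first by exists (line G x v); rewrite mulr1.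
case=> s sP ->; rewrite line_sum.
elim: s sP => [|[a b] s IHs] sP; first by exists 0; rewrite big_nil mul0r.
have [|r rE] := IHs; first by move=> p ps; apply: sP; rewrite inE ps orbT.
rewrite big_cons rE /=.
have [|c [d [/(_ x Zx) c0 /IHe[t dt] /= ->]]] := sP (a, b); first by rewrite inE eqxx.
have /factor_theorem[u cu] : root (line c x v) 0.
  by rewrite rootE line_horner scale0r addr0 c0.
exists (line a x v * u * t + r); rewrite !lineM dt cu subr0 exprS mulrDl.
by rewrite -!mulrA (mulrCA 'X).
Qed.

(* [p] is the reversal of [r] in degree [d]. *)
Lemma size_poly_reversal (K : numFieldType) (p r : {poly K}) d :
  (forall s, s != 0 -> p.[s] = s ^+ d * r.[s^-1]) -> (size p <= d.+1)%N.
Proof.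
move=> pE; pose N := size r.
(* [r'] is the reversal of [r] in degree [N]. Then ['X^N * p = 'X^d * r'] holds away from 0, hence
   identically, and sizes can be compared. *)
pose r' : {poly K} := \sum_(i < N) r`_i *: 'X^(N - i).
have szr' : (size r' <= N.+1)%N.
  apply: leq_trans (size_sum _ _ _) _; apply/bigmax_leqP => i _.
  apply: leq_trans (size_scale_leq _ _) _.
  by rewrite size_polyXn ltnS leq_subr.
have e : 'X^N * p = 'X^d * r'.
  apply/eqP; rewrite -subr_eq0; apply/eqP/poly_eq0_off0 => s s0.
  apply/eqP; rewrite hornerD hornerN !hornerM !hornerXn subr_eq0 pE // mulrCA; apply/eqP.
  congr (_ * _); rewrite horner_coef mulr_sumr horner_sum; apply: eq_bigr => i _.
  rewrite hornerZ hornerXn mulrCA; congr (_ * _).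
  by rewrite exprVn expfB_cond // (negbTE s0) add0n ltnW.
have [->|p0] := eqVneq p 0; first by rewrite size_poly0.
have sz : (size ('X^d * r')%R <= d + N.+1)%N.
  by apply: leq_trans (size_polyMleq _ _) _; rewrite size_polyXn addSn leq_add2l.
by move: sz; rewrite -e mulrC size_mulXn // addnS -addSn addnC leq_add2r.
Qed.

Lemma pos_part_subn (a b : nat) : pos_part (a%:Z - b%:Z) = (a - b)%N.
Proof.
case: (leqP b a) => le; first by rewrite subzn.
by have -> : (a - b)%N = 0%N by [lia]; case E : (a%:Z - b%:Z) => [m|//]; lia.
Qed.

(** * Sections on the wonderful variety and pole orders *)

Section Wonderful.
Context {K : numFieldType} {V : vectType K} {n : nat}.
Variables (ell : arrangement V n) (k : nat).
Implicit Types (g p q h : polyfun V) (x v w : V) (F : {set 'I_n}).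

Lemma flat_spaceP F v : reflect (forall i, i \in F -> ell i v = 0) (v \in flat_space ell F).
Proof.
apply: (iffP idP) => [vF i iF|vF].
  by apply/eqP; rewrite -memv_ker; apply: subvP vF; exact: bigcapv_inf iF _.
by apply/subv_bigcapP => i iF; rewrite -memvE memv_ker vF.
Qed.

(** On the cone over P(L_F) both [t] and every [ell i] with [i] in [F] vanish, so at least [#|F|]
    factors of the homogenization lie in its ideal. *)
Lemma zonotopal_wonderful g : zonotopal ell k setT g ->
  wonderful_sections ell k%:Z g.
Proof.
move=> gP F _; rewrite /pole_order_le; exists (n + k)%N.
have -> : pos_part ((n + k)%:Z - (n%:Z - #|F|%:Z + k%:Z)) = #|F|.
  by rewrite (_ : _ - _ = #|F|%:Z) //; lia.
elim: gP => [T h sT hk|p q _ [G1 [h1 e1 i1]] _ [G2 [h2 e2 i2]]]; last first.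
  exists (G1 + G2); split; [exact: rpredD| |exact: ideal_pow_add].
  by move=> v; rewrite !pevalD e1 e2.
have [H Hk He] := exists_homogenization hk.
pose b i := form_poly (if i \in T then dual_fst (ell i) else dual_snd).
exists (H * \prod_i b i); split.
- rewrite addnC dhomogM //.
  have := dhomog_prod_linear (enum 'I_n) (fun i => dhomog_form _ : b i \is 1.-homog).
  by rewrite size_enum_ord big_enum.
- move=> v; rewrite !pevalM He !peval_prod; congr (_ * _).
  rewrite [RHS]big_mkcond /=; apply: eq_bigr => i _.
  rewrite /b; case: ifP => _; first by rewrite !peval_form dual_fstE.
  by rewrite peval_form dual_sndE.
(* Outside [F] the factor is replaced by [t], since [ideal_pow_prod] asks for membership at every
   index. *)
- pose b' i := if i \in F then b i else form_poly dual_snd.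
  rewrite (bigID (mem F)) /= mulrCA mulrC.
  have -> : \prod_(i in F) b i = \prod_(i <- enum F) b' i.
    by rewrite -big_enum big_seq [RHS]big_seq; apply: eq_bigr => i; rewrite mem_enum /b' => ->.
  rewrite cardE; apply: ideal_pow_prod => i [v s] [/= vF ->].
  have snd0 : peval (form_poly dual_snd) (v, 0 : K^o) = 0.
    by rewrite peval_form dual_sndE.
  rewrite /b' /b; case: ifP => iF //; case: ifP => _ //.
  by rewrite peval_form dual_fstE; apply/flat_spaceP: iF.
Qed.

(** The line [x + s v] meets infinity at a point of P(L_F) for [F] the set of forms vanishing at
    [v]. Vanishing of [G] there to high order lowers the degree in [s]. *)
Lemma wonderful_inverse_system g : (\bigcap_(i < n) lker (ell i))%VS = 0%VS ->
  wonderful_sections ell k%:Z g -> inverse_system ell k%:Z g.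
Proof.
move=> ess gW; apply/inverse_system_natP => v v0 x.
pose F := [set i | ell i v == 0].
have vF : v \in flat_space ell F by apply/flat_spaceP => i; rewrite inE => /eqP.
have [|d [G [Gd Ge Gi]]] := gW F.
  split=> [j /subvP/(_ v vF)|]; first by rewrite memv_ker inE.
  apply: contraNneq v0 => FT; rewrite -memv0 -ess.
  by apply/subv_bigcapP => i _; rewrite -memvE memv_ker; have := in_setT i; rewrite -FT inE.
have nE : n = (rho ell v + #|F|)%N.
  rewrite rhoE -[LHS]card_ord -(cardsC F) addnC; congr (_ + _)%N.
  by apply: eq_card => i; rewrite !inE.
have eE : pos_part (d%:Z - (n%:Z - #|F|%:Z + k%:Z)) = (d - (rho ell v + k))%N.
  rewrite -pos_part_subn; congr (pos_part (_ - _)).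
  by move/(congr1 Posz): nE => ->; rewrite !PoszD addrK.
have [|r rE] := @line_ideal_pow _ _ _ _ G (v, 0 : K^o) (x, 1 : K^o) _ Gi.
  by split.
rewrite eE in rE.
(* With truncated subtraction this exponent is the minimum of [d] and [rho ell v + k]. *)
suff /size_poly_reversal sz : forall s, s != 0 ->
    (line g x v).[s] = s ^+ (d - (d - (rho ell v + k))) * r.[s^-1].
  by apply: leq_trans sz _; lia.
move=> s s0; rewrite line_horner -Ge.
(* In homogeneous coordinates the line tends to (v, 0) as s goes to infinity. *)
have -> : (x + s *: v, 1) = s *: ((v, 0 : K^o) + s^-1 *: (x, 1 : K^o)) :> (V * K^o)%type.
  congr (_, _) => /=.
    by rewrite scalerDr scalerA divff // scale1r addrC.
  by rewrite add0r /GRing.scale /= mulr1 divff.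
rewrite (peval_dhomog _ _ Gd) -line_horner rE hornerM hornerXn.
by rewrite exprVn (mulrC r.[_]) mulrA -expfB_cond // (negbTE s0) leq_subr.
Qed.

Lemma inverse_system_wonderful g : (\bigcap_(i < n) lker (ell i))%VS = 0%VS ->
  inverse_system ell k%:Z g <-> wonderful_sections ell k%:Z g.
Proof.
move=> ess; split; last exact: wonderful_inverse_system.
by move/inverse_system_zonotopal/zonotopal_wonderful.
Qed.
End Wonderful.

(** * The arrangement induced on a subspace *)

Lemma rho_restrict (K : numFieldType) (V : vectType K) n (ell : arrangement V n)
    (U : {vspace V}) (v : subvs_of U) :
  rho (arr_restrict U ell) v = rho ell (vsval v).
Proof.
by rewrite !rhoE; apply: eq_card => i; rewrite !inE comp_lfunE lfunE.
Qed.

Lemma cap_lker_restrict (K : numFieldType) (V : vectType K) n (ell : arrangement V n)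
    (U : {vspace V}) : (\bigcap_(i < n) lker (ell i))%VS = 0%VS ->
  (\bigcap_(i < n) lker (arr_restrict U ell i))%VS = 0%VS.
Proof.
move=> ess; apply/eqP; rewrite -subv0; apply/subvP => v vI.
rewrite memv0 -(inj_eq val_inj) /= -memv0 -ess memvE.
apply/subv_bigcapP => i _; rewrite -memvE memv_ker.
have : v \in lker (arr_restrict U ell i) by apply: subvP vI; exact: bigcapv_inf.
by rewrite memv_ker comp_lfunE lfunE.
Qed.

(** * Generic linear forms *)

Section Generic.
Context {K : numFieldType} {V : vectType K} {n : nat}.
Variable (ell : arrangement V n).
Implicit Types (g p q : polyfun V) (x v w : V) (f : dual V) (F : {set 'I_n}).

(** Vectors act as linear forms on the dual space, so that genericity becomes a polynomial condition
    on [f]. *)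
Definition eval_at v f : K^o := f v.

Fact eval_at_is_linear v : linear (eval_at v).
Proof. by move=> a f1 f2; rewrite /eval_at add_lfunE scale_lfunE. Qed.

HB.instance Definition _ v :=
  GRing.isLinear.Build K (dual V) K^o _ (eval_at v) (eval_at_is_linear v).

Lemma form_eval_at_neq0 v : v != 0 ->
  form_poly (linfun (eval_at v) : dual (dual V)) != 0.
Proof.
apply: contra_neq => e0; rewrite (vcoord_sum v) big1 // => i _.
have := peval_form (linfun (eval_at v) : dual (dual V))
  (linfun (coord (vbasis {:V}) i : V -> K^o)).
by rewrite e0 lfunE /= /eval_at lfunE /= -/(vcoord i v) => <-; rewrite /peval meval0 scale0r.
Qed.

(** One chosen nonzero vector in each nonzero L_F suffices, so finitely many linear conditions on
    [f] are multiplied together. *)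
Definition generic_poly : polyfun (dual V) :=
  \prod_(F : {set 'I_n} | flat_space ell F != 0%VS)
    form_poly (linfun (eval_at (vpick (flat_space ell F)))).

Lemma generic_polyP f : reflect
  (forall F, flat_space ell F != 0%VS -> f (vpick (flat_space ell F)) != 0)
  (peval generic_poly f != 0).
Proof.
rewrite peval_prod; apply: (iffP (prodf_neq0 _ _)) => nz F /nz;
  by rewrite peval_form lfunE.
Qed.

Lemma exists_generic : exists f, peval generic_poly f != 0.
Proof.
suff : generic_poly != 0.
  apply: contra_neqP => /forallNP all0; apply: peval_eq0 => f.
  by apply/eqP/negPn/negP/all0.
by apply/prodf_neq0 => F F0; rewrite form_eval_at_neq0 // vpick0.
Qed.

(** If [f v] is nonzero, the factor [f] takes away one degree. Otherwise [v] is moved slightly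
    within its own L_F, which cannot increase [rho]. *)
Lemma size_line_quotient_generic f q (k : nat) :
  (forall F, flat_space ell F != 0%VS -> f (vpick (flat_space ell F)) != 0) ->
  (forall v, v != 0 -> forall x,
     (size (line (form_poly f * q)%R x v) <= (rho ell v + k).+1)%N) ->
  forall v, v != 0 -> forall x, (size (line q x v) <= rho ell v + k)%N.
Proof.
move=> fgen sz.
have key v : f v != 0 -> forall x, (size (line q x v) <= rho ell v + k)%N.
  move=> fv x; apply: (@size_line_quotient _ _ fullv (form_poly f * q) f q v) => //.
  - by move=> y _; rewrite pevalM peval_form.
  - exact: memvf.
  - exact: memvf.
  - move=> y _; rewrite fv addn1 sz //; apply: contraNneq fv => ->.
    by rewrite linear0.
  - exact: memvf.
move=> v v0 x; have [fv|] := eqVneq (f v) 0; last by move/key.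
pose F := [set i | ell i v == 0].
have vF : v \in flat_space ell F by apply/flat_spaceP => i; rewrite inE => /eqP.
have F0 : flat_space ell F != 0%VS.
  by apply: contraNneq v0 => e; rewrite e memv0 in vF.
have := fgen F F0; set w := vpick _ => fw.
have wF : w \in flat_space ell F by exact: memv_pick.
(* v is a limit of vectors of the same flat on which f does not vanish. *)
apply: (@size_line_limit _ _ _ x 0 v w) => c c0; rewrite scaler0 addr0.
have fvw : f (v + c *: w) != 0 by rewrite dualD dualZ fv add0r mulf_neq0.
apply: leq_trans (key _ fvw x) _; rewrite leq_add2r !rhoE subset_leq_card //.
apply/subsetP => i; rewrite !inE; apply: contraNneq => iv.
have iF : i \in F by rewrite inE iv.
rewrite dualD dualZ iv; move/flat_spaceP: wF => ->//.
by rewrite mulr0 addr0.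
Qed.
End Generic.

(** * Surjectivity of restriction and the left exact sequence *)

Section Restriction.
Context {K : numFieldType} {V : vectType K} {n : nat}.
Variables (ell : arrangement V n) (k : nat).

Lemma restrict_inverse_system (U : {vspace V}) (g : polyfun V) :
  inverse_system ell k%:Z g -> inverse_system (arr_restrict U ell) k%:Z (restrict U g).
Proof.
move=> /inverse_system_natP gP; apply/inverse_system_natP => v v0 x.
by rewrite line_restrict rho_restrict gP // -[0]/(vsval (0 : subvs_of U)) (inj_eq val_inj).
Qed.

(** Any extension of [z] to [V] will do: only directions in [U] enter [zonotopal_restrict], which
    replaces it by a combination of products with the same values on [U]. *)
Lemma restrict_inverse_system_onto (U : {vspace V}) :
  maps_onto (inverse_system ell k%:Z) (inverse_system (arr_restrict U ell) k%:Z)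
    (restrict U).
Proof.
split=> [g|z /inverse_system_natP zP]; first exact: restrict_inverse_system.
have [g gE] := exists_pullback (linfun (vsproj U)) z.
have {}gE u : peval g (vsval u) = peval z u by rewrite gE lfunE /= vsvalK.
have [|y yP yg] := @zonotopal_restrict _ _ _ ell k setT U g; last first.
  exists y; first exact: zonotopal_inverse_system yP.
  by apply: peval_inj => u; rewrite peval_restrict yg ?gE // subvsP.
move=> v vU v0 x xU.
pose v' := Subvs vU; pose x' := Subvs xU.
have -> : line g x v = line z x' v'.
  by apply: poly_ext => s; rewrite !line_horner -gE linearD linearZ.
have v'0 : v' != 0 by rewrite -(inj_eq val_inj).
have := zP v' v'0 x'; rewrite rho_restrict rhoE /=.
by rewrite (@eq_card _ (mem [set i in setT | _]) (mem [set i | ell i v != 0%R])) // => i;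
  rewrite !inE.
Qed.

Lemma restrict_wonderful_onto (U : {vspace V}) :
  (\bigcap_(i < n) lker (ell i))%VS = 0%VS ->
  maps_onto (wonderful_sections ell k%:Z) (wonderful_sections (arr_restrict U ell) k%:Z)
    (restrict U).
Proof.
move=> ess; have essU := cap_lker_restrict U ess.
have [into onto] := restrict_inverse_system_onto U.
split=> [y /(inverse_system_wonderful k _ ess)/into|z].
  by move/(inverse_system_wonderful k _ essU).
move/(inverse_system_wonderful k _ essU)/onto => [y yC <-].
by exists y => //; apply/(inverse_system_wonderful k _ ess).
Qed.

Lemma left_exact_generic (f : dual V) :
  f != 0 ->
  (forall F, flat_space ell F != 0%VS -> f (vpick (flat_space ell F)) != 0) ->
  left_exact (inverse_system ell (k%:Z - 1)) (inverse_system ell k%:Z)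
    (inverse_system (arr_restrict (lker f) ell) k%:Z)
    (fun g => form_poly f * g) (restrict (lker f)).
Proof.
move=> f0 fgen.
have ff0 : form_poly f != 0.
  apply: contra_neq f0 => e; apply/lfunP => v.
  by rewrite -(peval_form f v) e lfunE /= /peval meval0.
split.
- move=> g /inverse_system_predP gP; apply/inverse_system_natP => v v0 x.
  rewrite lineM; apply: leq_trans (size_polyMleq _ _) _.
  have := gP v v0 x; have := size_line_form f x v; case: (f v != 0%R) => /=; lia.
- by move=> g; exact: restrict_inverse_system.
- by move=> x xP /eqP; rewrite mulf_eq0 (negbTE ff0) => /eqP.
- move=> y /inverse_system_natP yP; split=> [ry|[q _ ->]]; last first.
    apply: peval_eq0 => u; rewrite peval_restrict pevalM peval_form.
    by have := subvsP u; rewrite memv_ker => /eqP->; rewrite mul0r.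
  have [w fw] : exists w, f w != 0.
    apply: contra_notP (negP f0) => /forallNP fw; apply/eqP/lfunP => v.
    by rewrite lfunE; apply/eqP/negPn/negP/fw.
  pose w1 := (f w : K)^-1 *: w.
  have fw1 : f w1 = 1 by rewrite dualZ mulVf.
  (* The projection of [x] along [w1] lies in the kernel of [f], where [y] vanishes, so [y] is
     divisible by [f]. *)
  have [q qE] := exists_quotient f w1 y.
  have yE : y = form_poly f * q.
    apply: peval_inj => x; rewrite pevalM peval_form -qE.
    have xT : x - (f x : K) *: w1 \in lker f.
      by rewrite memv_ker dualB dualZ fw1 mulr1 subrr.
    rewrite -[in peval y (x - _)](vsprojK xT) -peval_restrict ry.
    by rewrite /peval meval0 subr0.
  exists q => //; apply/inverse_system_predP; apply: (size_line_quotient_generic fgen).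
  by rewrite -yE.
Qed.
End Restriction.

Theorem proposition3p21 (R : realType) (L : vectType R[i]) (n : nat)
    (ell : 'I_n -> dual L) :
  (0 < \dim {:L})%N ->
  (\bigcap_(i < n) lker (ell i))%VS = 0%VS ->
  exists U : dual L -> Prop,
    [/\ zariski_open U, exists f, U f
      & forall f, U f -> forall k : nat,
          let TL := lker f in
          let ellT := arr_restrict TL ell in
          [/\ left_exact (inverse_system ell (k%:Z - 1)) (inverse_system ell k%:Z)
                (inverse_system ellT k%:Z)
                (fun g => form_poly f * g) (restrict TL),
              maps_onto (inverse_system ell k%:Z) (inverse_system ellT k%:Z)
                (restrict TL)
            & maps_onto (wonderful_sections ell k%:Z) (wonderful_sections ellT k%:Z)
                (restrict TL)]].
Proof.
move=> dimL ess; exists (fun f => peval (generic_poly ell) f != 0); split.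
- exists (eq (generic_poly ell)) => f.
  by split=> [nz|[p <-]] //; exists (generic_poly ell).
- exact: exists_generic.
move=> f /generic_polyP fgen k TL ellT; split.
(* The empty index set has L_F equal to [L], nonzero by the dimension hypothesis; this forces [f] to
   be nonzero. *)
- apply: left_exact_generic => //; apply: contraTneq (fgen set0 _) => [->|].
    by rewrite lfunE eqxx.
  by rewrite /flat_space big_set0 -dimv_eq0 -lt0n.
- exact: restrict_inverse_system_onto.
- exact: restrict_wonderful_onto.
Qed.
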